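(* Every harmonic function in $\mathcal{D}$ is an energy minimizer. That is, if $h\in\mathcal{D}$ satisfies $\Delta h=0$, then there exists $n\ge 1$ such that $h$ is constant on every cylinder set of length $n$.
   Context: Fix an integer $N\ge 2$, $S=\{1,\dots,N\}$, and let $\Sigma_N^+=\{x=(x_1x_2\cdots):x_i\in S\}$ with the product topology. Cylinder sets (of length $m$): $[p_1\cdots p_m]=\{x: x_1=p_1,\dots,x_m=p_m\}$. $\mu$ is the Borel probability measure with $\mu([p_1\cdots p_m])=N^{-m}$. $\mathcal{C}(\Sigma_N^+)$ is the set of real continuous functions. For $m\ge 0$, $V_m$ is the set of sequences $p=(p_1\cdots p_m\,p_{m+1}\,p_{m+1}\cdots)$ that are constant from position $m+1$ on; $V_0\subset V_1\subset\cdots$, and $V_{-1}=\emptyset$. For $p\in V_m$, $\mathcal{U}_{p,m}=\{q\in V_m: q\ne p,\ q_i=p_i \text{ for } 1\le i\le m\}$ (a set of $N-1$ points; for $m=0$ it is $V_0\setminus\{p\}$). For $p\in\bigcup_m V_m$, $\kappa_p=\min\{j:p\in V_j\}$. For a real function $u$ defined (at least) on $V_m$ and $p\in V_m$, the difference operator is $$H_m u(p)=\sum_{j=\kappa_p}^{m}\ \sum_{q\in\mathcal{U}_{p,j}}(u(q)-u(p)).$$ Laplacian: for $u,f\in\mathcal{C}(\Sigma_N^+)$, $\Delta u=f$ means $\lim_{m\to\infty}\max_{p\in V_m\setminus V_{m-1}}\left|\frac{H_mu(p)}{\mu([p_1\cdots p_{m+1}])}-f(p)\right|=0$. $D_\mu$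 is the set of $u\in\mathcal{C}(\Sigma_N^+)$ for which such an $f$ exists. For $M\ge0$, $\mathcal{D}_M$ is the set of $u\in D_\mu$ for which there is $f\in\mathcal{C}(\Sigma_N^+)$ with $\Delta u=f$ and $\lim_{m\to\infty}\max_{p\in V_m\setminus V_M}\left|\frac{H_mu(p)}{\mu([p_1\cdots p_{m+1}])}-f(p)\right|=0$. $\mathcal{D}=\bigcup_{M\ge0}\mathcal{D}_M$. A function $h$ is harmonic if $\Delta h=0$. An energy minimizer is a function $\Sigma_N^+\to\mathbb{R}$ that is constant on each cylinder set of some particular length. *)

(* Defs.v *)
From HB Require Import structures.
From mathcomp Require Import all_boot all_order all_algebra.
From mathcomp Require Import all_classical all_reals all_analysis.

Set Implicit Arguments.
Unset Strict Implicit.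
Unset Printing Implicit Defensive.

Import Order.TTheory GRing.Theory Num.Theory.
Import numFieldNormedType.Exports.

Local Open Scope classical_set_scope.
Local Open Scope ring_scope.

(* For N >= 1 this is the type 'I_N of exactly N symbols; writing the bound as
   N.-1.+1 makes it inhabited for every N, which the library requires of the
   carrier of a measure. *)
Definition alphabet (N : nat) : Type := 'I_N.-1.+1.

HB.instance Definition _ N := Finite.on (alphabet N).
HB.instance Definition _ N := isPointed.Build (alphabet N) (@ord0 N.-1).

(* Positions are numbered from 0: the term x_i of (x_1 x_2 ...) is x i.-1. *)
Definition shift_space (N : nat) : Type :=
  prod_topology (fun _ : nat => discrete_topology (alphabet N)).

HB.instance Definition _ N := Pointed.on (shift_space N).
HB.instance Definition _ N := Topological.on (shift_space N).

Definition borel_shift_space (N : nat) :=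
  g_sigma_algebraType (@open (shift_space N)).

Section shift_space.
Context {N : nat}.
Implicit Types (p q x y : shift_space N) (m j : nat).

(* The cylinder [p_1 ... p_m]. Every word of length m is the prefix of some
   sequence p, so these are all the cylinder sets of length m. *)
Definition cylinder m p : set (shift_space N) :=
  [set x | forall i, (i < m)%N -> x i = p i].

Definition V m : set (shift_space N) :=
  [set p | forall i, (m <= i)%N -> p i = p m].

(* V m `\` V (m - 1), where V (-1) is empty *)
Definition newV m : set (shift_space N) :=
  V m `\` (if m is k.+1 then V k else set0).

Definition nbrs p m : set (shift_space N) :=
  [set q | [/\ V m q, q <> p & forall i, (i < m)%N -> q i = p i]].

(* the least j such that V j p; the default value 0 is used only when p belongs
   to no V j *)
Definition kappa p : nat :=
  xget 0%N [set j | V j p /\ forall k, V k p -> (j <= k)%N].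

Lemma kappaP p m : V m p -> V (kappa p) p /\ (kappa p <= m)%N.
Proof.
move=> Vmp.
have exV : exists j, `[< V j p >] by exists m; exact/asboolP.
have [j /asboolP Vj jmin] := ex_minnP exV.
rewrite /kappa; case: xgetP => [k _ [Vk kmin]|/(_ j) []].
  by split=> //; exact: kmin.
by split=> // k Vk; apply: jmin; exact/asboolP.
Qed.

Lemma V_finite m : finite_set (V m).
Proof.
pose ext (w : {ffun 'I_m.+1 -> alphabet N}) : shift_space N :=
  fun i => w (inord (minn i m)).
apply: (@sub_finite_set _ _ (range ext)); last first.
  by apply: finite_image; exact: finite_finset.
move=> p Vp; exists [ffun i => p (val i)] => //.
apply: functional_extensionality_dep => i; rewrite /ext ffunE /=.
rewrite inordK ?ltnS ?geq_minr//.
by have [mi|/ltnW im] := leqP m i; rewrite ?(minn_idPr mi) ?(minn_idPl im)// Vp.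
Qed.

Lemma nbrs_finite p m : finite_set (nbrs p m).
Proof. by apply: sub_finite_set (V_finite m) => q []. Qed.

Section laplacian.
Context {R : realType}.
Variable mu : probability (borel_shift_space N) R.
Implicit Types (u f h : shift_space N -> R) (M : nat).

Definition Hdiff m u p : R :=
  \sum_(kappa p <= j < m.+1) \sum_(q \in nbrs p j) (u q - u p).

(* The maximum, over the finite set A, of | H_m u(p) / mu [p_1 ... p_{m+1}]
   - f(p) |. The terms are nonnegative, so taking 0 as the starting value
   changes the result only in giving 0 for empty A. *)
Definition max_error (A : set (shift_space N)) m u f : R :=
  \big[Num.max/0]_(p \in A)
    `|Hdiff m u p / fine (mu (cylinder m.+1 p)) - f p|.

(* Delta u = f *)
Definition laplacian u f : Prop :=
  [/\ continuous u, continuous f &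
      max_error (newV m) m u f @[m --> \oo] --> (0 : R)].

Definition D_mu : set (shift_space N -> R) :=
  [set u | continuous u /\ exists f, laplacian u f].

Definition D_ M : set (shift_space N -> R) :=
  [set u | D_mu u /\ exists f, [/\ continuous f, laplacian u f &
      max_error (V m `\` V M) m u f @[m --> \oo] --> (0 : R)]].

Definition D : set (shift_space N -> R) := \bigcup_M D_ M.

Definition harmonic_function h : Prop := laplacian h (fun=> 0).

End laplacian.

Definition energy_minimizer {R : realType} (h : shift_space N -> R) : Prop :=
  exists2 n, (1 <= n)%N &
    forall p x y, cylinder n p x -> cylinder n p y -> h x = h y.

End shift_space.

(* Main.v *)
Require Import Defs.
From mathcomp Require Import all_boot all_order all_algebra.
From mathcomp Require Import all_classical all_reals all_analysis.
From mathcomp Require Import ring.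

Import Order.TTheory GRing.Theory Num.Theory.
Import numFieldNormedType.Exports.

Local Open Scope classical_set_scope.
Local Open Scope ring_scope.

(** The idea is to look at the contribution of a single level j to H_m h(p),
    D_j(p) = the sum of h(q) - h(p) over the neighbours q of p at level j
    ([level_diff]), and to show that it vanishes for all j > M when h is a
    harmonic function of class D_M.

    By density of the new points and continuity, the function f with
    Delta h = f is unique ([laplacian_unique]); hence the f provided by the
    membership of h in D_M is 0, and the quantities N^(m+1) |H_m h(p)|, for p in
    V_m but not in V_M, are bounded by some e_m with e_m --> 0.

    The D_j(q), for q running over the N points of V_j in one cylinder of length
    j, sum to zero ([sum_level_diff]). If p already belongs to V_(j-1), the
    other N - 1 of these points are new at level j, so a bound B on |D_j| at the
    new points of level j gives |D_j(p)| <= (N - 1) B at the old ones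
    ([level_diff_old_le]).

    Now fix m, and let p be new at level k, with M < k <= m. Then
    D_k(p) = H_m h(p) - (D_(k+1)(p) + ... + D_m(p)), and p is old at the levels
    k + 1, ..., m. Descending induction on k gives |D_k(p)| <= e_m N^(-k),
    because (N - 1) (N^(-k-1) + ... + N^(-m)) = N^(-k) - N^(-m), which leaves
    exactly the room needed for |H_m h(p)| <= e_m N^(-m) ([level_diff_decay]).
    The constant does not deteriorate with m - k, so letting m tend to infinity
    yields D_k(p) = 0 for every new p of every level k > M, and then also for
    the old ones. Therefore h takes one value on the N points of V_k in a
    cylinder of length k > M ([level_diff_eq0_const]); descending from level to
    level, h is constant on the points with constant tail of a cylinder of
    length M + 1 ([const_tail_reduce]), and by density on the whole cylinder. *)

(** * Sequences with constant tail *)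

(** The sequence p_1 ... p_j a a a ..., which agrees with p on its first j
    terms and is constant, equal to a, afterwards. For fixed p and j these are
    the N points of V j in the cylinder of length j around p. *)
Definition const_tail {N} (p : shift_space N) (j : nat) (a : alphabet N) :
    shift_space N :=
  fun i => if (i < j)%N then p i else a.

Lemma eq_const_tail {N} (p q : shift_space N) j a :
  (forall i, (i < j)%N -> p i = q i) -> const_tail p j a = const_tail q j a.
Proof.
by move=> pq; apply: funext => i; rewrite /const_tail; case: ifP => // /pq.
Qed.

Lemma V_const_tail {N} (p : shift_space N) j a : V j (const_tail p j a).
Proof. by move=> i ji; rewrite /const_tail ltnn ltnNge ji. Qed.

Lemma const_tail_id {N} (p : shift_space N) j :
  V j p -> const_tail p j (p j) = p.
Proof.
move=> Vp; apply: funext => i; rewrite /const_tail.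
by case: ltnP => // /Vp.
Qed.

Lemma const_tailK {N} (p : shift_space N) i j a b : (i <= j)%N ->
  const_tail (const_tail p j a) i b = const_tail p i b.
Proof.
by move=> ij; apply: eq_const_tail => k ki; rewrite /const_tail (leq_trans ki).
Qed.

Lemma V_le {N} (p : shift_space N) i j : (i <= j)%N -> V i p -> V j p.
Proof. by move=> ij Vp k jk; rewrite Vp ?(leq_trans ij)// (Vp j). Qed.

Lemma kappa_newV {N} (p : shift_space N) k : newV k p -> kappa p = k.
Proof.
move=> [Vp nVp]; have [Vkp kle] := kappaP Vp.
apply/eqP; rewrite eqn_leq kle /=; case: k nVp {Vp kle} => // k nVp.
by rewrite ltnNge; apply/negP => le; apply: nVp; exact: V_le Vkp.
Qed.

Lemma newV_not_V {N} (p : shift_space N) k M :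
  (M < k)%N -> newV k p -> ~ V M p.
Proof. by case: k => // k Mk [_ nV] VM; apply: nV; exact: V_le VM. Qed.

(** Prolonging the first j + 1 terms of p by a letter other than the last of
    them gives a point that is new at level j + 1. *)
Lemma newV_const_tail {N} (p : shift_space N) j a :
  a <> p j -> newV j.+1 (const_tail p j.+1 a).
Proof.
move=> ap; split; first exact: V_const_tail.
by move=> /(_ j.+1 (leqnSn j)); rewrite /const_tail ltnn ltnSn.
Qed.

Lemma nbrsE {N} (p : shift_space N) j : V j p ->
  nbrs p j = const_tail p j @` [set a | a <> p j].
Proof.
move=> Vp; apply/seteqP; split => [q [Vq qp qE]|_ [a ap <-]].
  have qj : const_tail p j (q j) = q.
    by rewrite -[RHS](const_tail_id _ _ Vq); apply: eq_const_tail => i /qE.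
  by exists (q j) => //= qpj; apply: qp; rewrite -qj qpj const_tail_id.
split; first exact: V_const_tail.
  by move=> E; apply: ap; rewrite -E /const_tail ltnn.
by move=> i ij; rewrite /const_tail ij.
Qed.

(** The points with constant tail are dense: x is the limit of the sequences
    that share its first n terms. *)
Lemma const_tail_cvg {N} {R : realType} (f : shift_space N -> R)
    (x : shift_space N) (a : nat -> alphabet N) : continuous f ->
  f (const_tail x n (a n)) @[n --> \oo] --> f x.
Proof.
move=> cf.
apply: (@cvg_comp _ _ _ (fun n => const_tail x n (a n)) f _ (nbhs x));
  last exact: cf.
(* It suffices to look at one coordinate i, where the sequence is eventually
   equal to x i. *)
apply/cvg_sup => i U [/= _ [[B /= oB <-] /= Bx]] /filterS; apply.
exists i.+1 => // n /= lin; rewrite /const_tail /=.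
by rewrite lin.
Qed.

(** * The Laplacian *)

Lemma le_max_error {N} {R : realType} (mu : probability (borel_shift_space N) R)
    (A : set (shift_space N)) m (u f : shift_space N -> R) p :
  finite_set A -> A p ->
  `|Hdiff m u p / fine (mu (cylinder m.+1 p)) - f p| <= max_error mu A m u f.
Proof.
move=> finA Ap.
pose F q := `|Hdiff m u q / fine (mu (cylinder m.+1 q)) - f q|.
rewrite /max_error -[X in X <= _]/(F p).
(* The support of a finitely supported big operator omits the indices at which
   the term is 0; there the bound holds because the maximum starts from 0. *)
have [->|Fp0] := eqVneq (F p) 0; first exact: bigmax_ge_id.
apply: le_bigmax_seq => //.
rewrite in_finite_support ?inE; first by split => //; exact/eqP.
exact: sub_finite_set finA.
Qed.

(** Two choices for Delta u are close at the new points of level m, by the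
    triangle inequality, and every x is a limit of such points. At least two
    letters are needed for new points to exist. *)
Lemma laplacian_unique {N} (hN : (2 <= N)%N) {R : realType}
    (mu : probability (borel_shift_space N) R) (u f g : shift_space N -> R) :
  laplacian mu u f -> laplacian mu u g -> f = g.
Proof.
move=> [_ cf ef] [_ cg eg]; apply: funext => x.
(* b c is a letter other than c. *)
pose b (c : alphabet N) : alphabet N := if c == ord0 then ord_max else ord0.
have bP c : b c <> c.
  rewrite /b; case: (eqVneq c ord0) => [-> /(congr1 val) /= e|/eqP nc e].
    by move: hN; rewrite -ltn_predRL e.
  exact: nc.
pose q n := const_tail x n (b (x n.-1)).
have cfg : `|f (q n) - g (q n)| @[n --> \oo] --> `|f x - g x|.
  by apply: cvg_norm; apply: cvgB; exact: const_tail_cvg.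
have : `|f x - g x| <= 0 + 0.
  apply: ler_cvg_to cfg (cvgD ef eg) _.
  near=> n.
  have Vq : newV n (q n).
    near: n; exists 1%N => // -[//|n] _; apply: newV_const_tail; exact: bP.
  have fin : finite_set (@newV N n).
    by apply: sub_finite_set (@V_finite N n) => ? [].
  have := le_max_error mu (newV n) n u f (q n) fin Vq.
  have := le_max_error mu (newV n) n u g (q n) fin Vq.
  rewrite -/(q n) /=; set X := Hdiff _ _ _ / _ => Hg Hf.
  rewrite (_ : f (q n) - g (q n) = (X - g (q n)) - (X - f (q n))); last by ring.
  by rewrite (le_trans (ler_normB _ _))// addrC lerD.
by rewrite addr0 normr_le0 subr_eq0 => /eqP.
Unshelve. all: by end_near.
Qed.

(** * The difference operator of one level *)

(** The contribution of level j to the difference operator at p: by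
    [sum_nbrs], for p in V j, it is the sum of u q - u p over the neighbours q
    of p at level j. Here q runs over all N points of V j in the cylinder of
    length j around p; the point p itself contributes 0. *)
Definition level_diff {N} {R : realType} (u : shift_space N -> R) j
    (p : shift_space N) : R :=
  \sum_(a : alphabet N) (u (const_tail p j a) - u p).

Lemma sum_nbrs {N} {R : realType} (u : shift_space N -> R) j p : V j p ->
  \sum_(q \in nbrs p j) (u q - u p) = level_diff u j p.
Proof.
move=> Vp; rewrite nbrsE// fsbig_image /=; last first.
  by move=> a b _ _ /(congr1 (@^~ j)); rewrite /const_tail ltnn.
rewrite /level_diff [RHS]fsbig_seq ?index_enum_uniq//.
apply: fsbig_widen => a /=; first by rewrite mem_index_enum.
by move=> [_ /contrapT ->]; rewrite const_tail_id// subrr.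
Qed.

Lemma Hdiff_newV {N} {R : realType} (u : shift_space N -> R) m k p :
  newV k p -> Hdiff m u p = \sum_(k <= j < m.+1) level_diff u j p.
Proof.
move=> kp; rewrite /Hdiff (kappa_newV _ _ kp).
apply: eq_big_nat => j /andP[kj _]; apply: sum_nbrs.
by case: kp => Vp _; exact: V_le Vp.
Qed.

Lemma level_diffE {N} {R : realType} (u : shift_space N -> R) j p :
  level_diff u j p =
  \sum_(a : alphabet N) u (const_tail p j a) - u p *+ N.-1.+1.
Proof. by rewrite /level_diff sumrB sumr_const card_ord. Qed.

Lemma level_diff_const_tail {N} {R : realType} (u : shift_space N -> R) j p a :
  level_diff u j (const_tail p j a) =
  \sum_(b : alphabet N) u (const_tail p j b) -
  u (const_tail p j a) *+ N.-1.+1.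
Proof.
by rewrite level_diffE; under eq_bigr do rewrite const_tailK//.
Qed.

Lemma sum_level_diff {N} {R : realType} (u : shift_space N -> R) j p :
  \sum_(a : alphabet N) level_diff u j (const_tail p j a) = 0.
Proof.
under eq_bigr do rewrite level_diff_const_tail.
by rewrite sumrB sumr_const card_ord -sumrMnl subrr.
Qed.

(** The value at an old point p, in terms of the new points of level j + 1 in
    the same cylinder: those that end in a letter other than the last common
    one, which is p j. *)
Lemma level_diff_old {N} {R : realType} (u : shift_space N -> R) j p :
  V j p ->
  level_diff u j.+1 p =
  - \sum_(a : alphabet N | a != p j) level_diff u j.+1 (const_tail p j.+1 a).
Proof.
move=> Vp; apply/eqP; rewrite -addr_eq0; apply/eqP.
have pE : const_tail p j.+1 (p j) = p.
  by rewrite -(Vp j.+1)// const_tail_id//; exact: V_le Vp.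
by rewrite -[RHS](sum_level_diff u j.+1 p) [RHS](bigD1 (p j))//= pE.
Qed.

Lemma level_diff_old_le {N} {R : realType} (u : shift_space N -> R) j p
    (B : R) :
  (forall q, newV j.+1 q -> `|level_diff u j.+1 q| <= B) ->
  V j p -> `|level_diff u j.+1 p| <= B *+ N.-1.
Proof.
move=> newB Vp; rewrite level_diff_old// normrN.
apply: (le_trans (ler_norm_sum _ _ _)).
have -> : B *+ N.-1 = \sum_(a : alphabet N | a != p j) B.
  by rewrite sumr_const (cardC1 (p j)) card_ord.
by apply: ler_sum => a /eqP ap; apply: newB; exact: newV_const_tail.
Qed.

(** The main estimate. The constant d in the conclusion is the one of the
    hypothesis, independently of m. *)
Lemma level_diff_decay {N} (hN : (0 < N)%N) {R : realType}
    (u : shift_space N -> R) M m (d : R) :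
  (forall p, V m p -> ~ V M p -> `|Hdiff m u p| <= d / N%:R ^+ m) ->
  forall k p, (M < k <= m)%N -> newV k p ->
  `|level_diff u k p| <= d / N%:R ^+ k.
Proof.
move=> Hm k.
have [n] := ubnP (m - k); elim: n k => // n IH k mk p /andP[Mk km] kp.
have Vp : V k p by case: kp.
have N0 : (N%:R : R) != 0 by rewrite pnatr_eq0 -lt0n.
(* At the later levels p is old; the bound is written as a telescoping term. *)
have later j : (k < j < m.+1)%N ->
    `|level_diff u j p| <= d / N%:R ^+ j.-1 - d / N%:R ^+ j.
  case: j => // j /andP[kj jm].
  have -> : d / N%:R ^+ j.+1.-1 - d / N%:R ^+ j.+1
      = (d / N%:R ^+ j.+1) *+ N.-1.
    rewrite /= -[RHS]mulr_natr -subn1 natrB// exprS.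
    by field; rewrite N0 expf_neq0.
  apply: level_diff_old_le; last exact: V_le Vp.
  move=> q; apply: IH; last by rewrite (leq_trans Mk)//= ltnW.
  by rewrite -ltnS (leq_trans _ mk)// ltnS ltn_sub2l// (leq_trans kj).
have Hle := Hm p (V_le p k m km Vp) (newV_not_V p k M Mk kp).
move: Hle; rewrite (Hdiff_newV _ _ _ _ kp) big_ltn//.
set T := \sum_(_ <= _ < _) _ => Hle.
have Tle : `|T| <= d / N%:R ^+ k - d / N%:R ^+ m.
  apply: (le_trans (ler_norm_sum _ _ _)).
  apply: (le_trans (ler_sum_nat later)).
  rewrite big_add1 /=.
  rewrite (eq_bigr (fun j => (- (d / N%:R ^+ j.+1)) - (- (d / N%:R ^+ j)))).
    by rewrite (telescope_sumr (fun j => - (d / N%:R ^+ j)))// opprK addrC.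
  by move=> j _; rewrite opprK addrC.
rewrite (_ : level_diff u k p = (level_diff u k p + T) - T); last by ring.
apply: (le_trans (ler_normB _ _)).
by apply: (le_trans (lerD Hle Tle)); rewrite addrC subrK.
Qed.

(** * Harmonic functions in the domain *)

Lemma level_diff_newV_eq0 {N} (hN : (0 < N)%N) {R : realType}
    (mu : probability (borel_shift_space N) R)
    (hmu : forall (m : nat) (p : shift_space N),
      mu (cylinder m p) = ((N%:R ^- m : R)%:E)%E)
    (h : shift_space N -> R) M :
  max_error mu (V m `\` V M) m h (fun=> 0) @[m --> \oo] --> (0 : R) ->
  forall k p, (M < k)%N -> newV k p -> level_diff h k p = 0.
Proof.
move=> e0 k p Mk kp; apply/eqP; rewrite -normr_le0.
have N1 : 1 <= N%:R :> R by rewrite ler1n.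
have Ngt0 n : 0 < N%:R ^+ n :> R by rewrite exprn_gt0// (lt_le_trans _ N1).
have e0' : max_error mu (V m `\` V M) m h (fun=> 0) / N%:R ^+ k
    @[m --> \oo] --> (0 / N%:R ^+ k : R) by exact: cvgM e0 (cvg_cst _).
rewrite mul0r in e0'.
apply: (ler_cvg_to (cvg_cst _) e0').
exists k => // m /= km.
(* [level_diff_decay] applies with d the maximal error of level m. *)
apply: (@level_diff_decay N hN R h M m) => //; last by rewrite Mk.
move=> q Vq nVq.
have fin : finite_set (@V N m `\` V M).
  by apply: sub_finite_set (@V_finite N m) => ? [].
have := le_max_error mu _ m h (fun=> 0) q fin (conj Vq nVq).
rewrite subr0 hmu /= invrK normrM (ger0_norm (ltW (Ngt0 _))) => le_e.
rewrite ler_pdivlMr//; apply: le_trans le_e.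
(* The measure of the cylinder is N^(-m-1), slightly better than needed. *)
by rewrite ler_wpM2l// ler_weXn2l.
Qed.

(** If the contributions of one level vanish at the new points of the level,
    they vanish at all its points, by [level_diff_old]; every value of h at a
    point of the level is then the average of h over the N points of the level
    in the same cylinder. *)
Lemma level_diff_eq0_const {N} {R : realType} (h : shift_space N -> R) k :
  (forall p, newV k.+1 p -> level_diff h k.+1 p = 0) ->
  forall p a, V k.+1 p -> h (const_tail p k.+1 a) = h p.
Proof.
move=> new0.
have all0 p : V k.+1 p -> level_diff h k.+1 p = 0.
  move=> Vp; have [Vkp|nVkp] := pselect (V k p); last by apply: new0; split.
  rewrite level_diff_old// big1 ?oppr0// => a /eqP ap.
  by apply: new0; exact: newV_const_tail.
move=> p a Vp.
have /eqP := all0 _ Vp.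
have /eqP := all0 _ (V_const_tail p k.+1 a).
rewrite level_diff_const_tail level_diffE !subr_eq0 => /eqP -> /eqP.
exact: (@pmulrnI _ N.-1.+1).
Qed.

(** Descent from level n + M.+1 to level M.+1; the value of h does not depend on
    the letter repeated in the tail, at either level. *)
Lemma const_tail_reduce {N} {R : realType}
    (h : shift_space N -> R) M :
  (forall k p, (M < k)%N -> newV k p -> level_diff h k p = 0) ->
  forall n x a b, h (const_tail x (n + M.+1) a) = h (const_tail x M.+1 b).
Proof.
move=> new0; elim=> [|n IH] x a b.
  rewrite add0n -[in LHS](const_tailK x M.+1 M.+1 b)//.
  apply: level_diff_eq0_const (V_const_tail _ _ _) => // p; exact: new0.
(* A tail starting at the term of index n + M.+1 and equal to that term also
   starts one index later. *)
rewrite -(IH x (x (n + M.+1)%N)).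
have -> : const_tail x (n + M.+1) (x (n + M.+1)%N) =
    const_tail x (n.+1 + M.+1) (x (n + M.+1)%N).
  apply: funext => i; rewrite /const_tail addSn.
  rewrite [in RHS]ltnS [in RHS]leq_eqVlt.
  by case: eqVneq => [->|]; rewrite ?ltnn.
rewrite -[in LHS](const_tailK x _ (n.+1 + M.+1) (x (n + M.+1)%N) a)//.
apply: level_diff_eq0_const (V_const_tail _ _ _) => // p; apply: new0.
exact: (leq_addl n.+1 M.+1).
Qed.

Theorem theorem4p5 (R : realType) (N : nat) (hN : (2 <= N)%N)
    (mu : probability (borel_shift_space N) R)
    (hmu : forall (m : nat) (p : shift_space N),
      mu (cylinder m p) = ((N%:R ^- m : R)%:E)%E)
    (h : shift_space N -> R) (hD : D mu h) (hharm : harmonic_function mu h) :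
  energy_minimizer h.
Proof.
have [M _ [_ [f [_ hf ]]]] := hD.
rewrite (laplacian_unique hN mu h f (fun=> 0) hf hharm) => e0.
have N0 : (0 < N)%N by exact: ltnW.
have red := const_tail_reduce h M (level_diff_newV_eq0 N0 mu hmu h M e0).
have [ch _ _] := hharm.
(* By density, h x is the value of h at one point of level M.+1 in the cylinder
   of length M.+1 around x. *)
have hE x : h x = h (const_tail x M.+1 ord0).
  have cx := const_tail_cvg h x (fun=> ord0) ch.
  have cM : h (const_tail x n ord0) @[n --> \oo] --> h (const_tail x M.+1 ord0).
    rewrite -(cvg_shiftn M.+1) /=.
    under eq_fun do rewrite (red _ x ord0 ord0).
    exact: cvg_cst.
  exact: (cvg_unique (@norm_hausdorff _ R) cx cM).
exists M.+1 => // p x y px py; rewrite hE [RHS]hE; congr h.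
by apply: eq_const_tail => i iM; rewrite px// py.
Qed.
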